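(* Let $\mathbf{L}$ be a normal modal logic containing $\mathbf{S4}$. Then the global consequence relation $\vdash_{\mathbf{L}}$ has a weak excluded middle law (WEML) if and only if $\vdash_{\mathbf{L}}\Diamond\Box v\to\Box\Diamond v$ (i.e., $\mathbf{L}$ extends $\mathbf{S4.2}$).
   Context: $\mathbb{N}^+=\{1,2,\dots\}$; $v_1,v_2,\dots$ is a fixed sequence of distinct variables from the infinite set of variables, and $v=v_1$. A modal formula is a formula in the signature of classical propositional logic expanded by a unary connective $\Box$; $\Diamond\alpha$ abbreviates $\neg\Box\neg\alpha$. A normal modal logic $\mathbf{L}$ is a set of modal formulas that contains all classical tautologies and $\Box(v_1\to v_2)\to(\Box v_1\to\Box v_2)$, and is closed under substitution, modus ponens and necessitation (from $\alpha$ infer $\Box\alpha$). Its global consequence relation $\vdash_{\mathbf{L}}$ is defined by: $\Gamma\vdash_{\mathbf{L}}\alpha$ iff $\alpha$ is derivable from $\Gamma\cup\mathbf{L}$ using the rules of modus ponens and necessitation. The theorems of $\vdash_{\mathbf{L}}$ are exactly the elements of $\mathbf{L}$. $\mathbf{S4}$ is the smallest normal modal logic containing $\Box v\to v$ and $\Box v\to\Box\Box v$; $\mathbf{S4.2}$ is the smallest normal modal logic containing $\mathbf{S4}$ and $\Diamond\Box v\to\Box\Diamond v$. Definition of WEML. Let $\mathit{Fm}$ be the set of all modal formulas and $\mathit{Fm}(n)$ the set of those whose variables are among $v_1,\dots,v_n$. For $\Psi\subseteq\mathit{Fm}(n)$, $\Psi(\alpha_1,\dots,\alpha_n)$ is the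 result of substituting $\alpha_i$ for $v_i$ in all members of $\Psi$; $\Gamma\vdash\Pi$ means $\Gamma\vdash\alpha$ for all $\alpha\in\Pi$. A set $\Xi$ of formulas is inconsistent in $\vdash$ if $\Xi\vdash\alpha$ for all $\alpha\in\mathit{Fm}$. An elementary IL-sequence for $\vdash$ is a family $\{\Psi_n:n\in\mathbb{N}^+\}$ of finite sets $\Psi_n\subseteq\mathit{Fm}(n)$ such that for all $n\in\mathbb{N}^+$ and all $\Gamma\cup\{\alpha_1,\dots,\alpha_n\}\subseteq\mathit{Fm}$: $\Gamma\cup\{\alpha_1,\dots,\alpha_n\}$ is inconsistent in $\vdash$ iff $\Gamma\vdash\Psi_n(\alpha_1,\dots,\alpha_n)$. Given such a sequence, let $\#n=|\Psi_n|$, $\Psi_n=\{\psi_n^1,\dots,\psi_n^{\#n}\}$ and $\Psi_{\#n}\Psi_n=\Psi_{\#n}(\psi_n^1,\dots,\psi_n^{\#n})\subseteq\mathit{Fm}(n)$ (the order of enumeration is immaterial up to interderivability). $\vdash$ has a WEML if it has an elementary IL-sequence $\{\Psi_n\}$ such that for all $n\in\mathbb{N}^+$ and all $\Gamma\cup\{\alpha_1,\dots,\alpha_n,\varphi\}\subseteq\mathit{Fm}$: if $\Gamma\cup\Psi_n(\alpha_1,\dots,\alpha_n)\vdash\varphi$ and $\Gamma\cup\Psi_{\#n}\Psi_n(\alpha_1,\dots,\alpha_n)\vdash\varphi$, then $\Gamma\vdash\varphi$. (If $\Psi_n=\emptyset$, this condition for $n$ is trivially true.) *)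

(* Defs.v *)
From HB Require Import structures.
From mathcomp Require Import all_boot finmap.
From mathcomp Require Import boolp classical_sets.

Set Implicit Arguments.
Unset Strict Implicit.
Unset Printing Implicit Defensive.

Local Open Scope classical_set_scope.

Inductive Fm (V : Type) : Type :=
| Var of V
| Bot
| Top
| Neg of Fm V
| And of Fm V & Fm V
| Or  of Fm V & Fm V
| Imp of Fm V & Fm V
| Box of Fm V.

Arguments Bot {V}.
Arguments Top {V}.

Definition Dia (V : Type) (a : Fm V) : Fm V := Neg (Box (Neg a)).

(* Needed only to form {fset Fm V}, the finite sets of formulas. *)
Section FmChoice.
Variable V : choiceType.

Fixpoint fm_encode (a : Fm V) : GenTree.tree V :=
  match a with
  | Var x => GenTree.Leaf x
  | Bot => GenTree.Node 0 [::]
  | Top => GenTree.Node 1 [::]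
  | Neg b => GenTree.Node 2 [:: fm_encode b]
  | And b c => GenTree.Node 3 [:: fm_encode b; fm_encode c]
  | Or b c => GenTree.Node 4 [:: fm_encode b; fm_encode c]
  | Imp b c => GenTree.Node 5 [:: fm_encode b; fm_encode c]
  | Box b => GenTree.Node 6 [:: fm_encode b]
  end.

Fixpoint fm_decode (t : GenTree.tree V) : Fm V :=
  match t with
  | GenTree.Leaf x => Var x
  | GenTree.Node 1 _ => Top
  | GenTree.Node 2 [:: b] => Neg (fm_decode b)
  | GenTree.Node 3 [:: b; c] => And (fm_decode b) (fm_decode c)
  | GenTree.Node 4 [:: b; c] => Or (fm_decode b) (fm_decode c)
  | GenTree.Node 5 [:: b; c] => Imp (fm_decode b) (fm_decode c)
  | GenTree.Node 6 [:: b] => Box (fm_decode b)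
  | _ => Bot
  end.

Lemma fm_encodeK : cancel fm_encode fm_decode.
Proof. by elim=> //= [a ->|a -> b ->|a -> b ->|a -> b ->|a ->]. Qed.

HB.instance Definition _ := Choice.copy (Fm V) (can_type fm_encodeK).

End FmChoice.

Fixpoint subst (V : Type) (s : V -> Fm V) (a : Fm V) : Fm V :=
  match a with
  | Var x => s x
  | Bot => Bot
  | Top => Top
  | Neg b => Neg (subst s b)
  | And b c => And (subst s b) (subst s c)
  | Or b c => Or (subst s b) (subst s c)
  | Imp b c => Imp (subst s b) (subst s c)
  | Box b => Box (subst s b)
  end.

Fixpoint vars (V : Type) (a : Fm V) : seq V :=
  match a with
  | Var x => [:: x]
  | Bot | Top => [::]
  | Neg b | Box b => vars b
  | And b c | Or b c | Imp b c => vars b ++ vars c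
  end.

(* Truth value of a modal formula in classical propositional logic: variables
   and boxed formulas are treated as atoms, with truth values given by h. *)
Fixpoint eval (V : Type) (h : Fm V -> bool) (a : Fm V) : bool :=
  match a with
  | Var _ | Box _ => h a
  | Bot => false
  | Top => true
  | Neg b => ~~ eval h b
  | And b c => eval h b && eval h c
  | Or b c => eval h b || eval h c
  | Imp b c => eval h b ==> eval h c
  end.

Definition tautology (V : Type) (a : Fm V) : Prop := forall h, eval h a.

(* X |- a, for the global consequence relation of L. *)
Inductive gcons (V : Type) (L X : set (Fm V)) : Fm V -> Prop :=
| gcons_hyp a : X a -> gcons L X a
| gcons_thm a : L a -> gcons L X a
| gcons_mp a b : gcons L X (Imp a b) -> gcons L X a -> gcons L X b
| gcons_nec a : gcons L X a -> gcons L X (Box a).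

(* The sequence of distinct variables v_1, v_2, ... is an injection
   v : nat -> V, with v_(i+1) rendered as v i. *)

Section NormalModalLogics.
Variables (V : Type) (v : nat -> V).

Record normal_logic (L : set (Fm V)) : Prop := NormalLogic {
  normal_taut : forall a, tautology a -> L a;
  normal_K : L (Imp (Box (Imp (Var (v 0)) (Var (v 1))))
                    (Imp (Box (Var (v 0))) (Box (Var (v 1)))));
  normal_subst : forall s a, L a -> L (subst s a);
  normal_mp : forall a b, L (Imp a b) -> L a -> L b;
  normal_nec : forall a, L a -> L (Box a)
}.

Definition smallest_normal (A : set (Fm V)) : set (Fm V) :=
  [set a | forall L, normal_logic L -> A `<=` L -> L a].

Definition axT : Fm V := Imp (Box (Var (v 0))) (Var (v 0)).
Definition ax4 : Fm V := Imp (Box (Var (v 0))) (Box (Box (Var (v 0)))).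
Definition axG : Fm V := Imp (Dia (Box (Var (v 0)))) (Box (Dia (Var (v 0)))).

Definition S4 : set (Fm V) := smallest_normal [set axT; ax4].
Definition S42 : set (Fm V) := smallest_normal (S4 `|` [set axG]).

End NormalModalLogics.

Section WEML.
Variables (V : choiceType) (v : nat -> V).

(* Fm(n) *)
Definition Fmn (n : nat) : set (Fm V) :=
  [set a | {subset vars a <= mkseq v n}].

(* The substitution v_i |-> alpha_i for 1 <= i <= n, where
   al = (alpha_1, ..., alpha_n); the other variables are left unchanged. *)
Definition tsubst (n : nat) (al : n.-tuple (Fm V)) (x : V) : Fm V :=
  nth (Var x) al (index x (mkseq v n)).

(* Psi(alpha_1, ..., alpha_n) *)
Definition inst (n : nat) (Psi : set (Fm V)) (al : n.-tuple (Fm V)) :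
    set (Fm V) :=
  subst (tsubst al) @` Psi.

Variable cons : set (Fm V) -> Fm V -> Prop.

Definition cons_all (X Y : set (Fm V)) : Prop := forall a, Y a -> cons X a.

Definition inconsistent (X : set (Fm V)) : Prop := forall a, cons X a.

(* Families indexed by the positive integers are functions on nat whose value
   at 0 is unconstrained. *)
Definition elementary_IL (Psi : nat -> {fset Fm V}) : Prop :=
  forall n, 0 < n ->
    [set` Psi n] `<=` Fmn n /\
    forall (X : set (Fm V)) (al : n.-tuple (Fm V)),
      inconsistent (X `|` [set` al]) <-> cons_all X (inst [set` Psi n] al).

(* Psi_{#n} Psi_n, the members of Psi_n being enumerated as in enum_fset. *)
Definition PsiPsi (Psi : nat -> {fset Fm V}) (n : nat) : set (Fm V) :=
  inst [set` Psi #|` Psi n|] (in_tuple (enum_fset (Psi n))).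

(* If Psi n is empty, then PsiPsi Psi n involves the irrelevant value Psi 0,
   but the condition for n follows from its first premise alone. *)
Definition has_WEML : Prop :=
  exists2 Psi : nat -> {fset Fm V}, elementary_IL Psi &
    forall n, 0 < n ->
    forall (X : set (Fm V)) (al : n.-tuple (Fm V)) (phi : Fm V),
      cons (X `|` inst [set` Psi n] al) phi ->
      cons (X `|` inst (PsiPsi Psi n) al) phi ->
      cons X phi.

End WEML.

(* Main.v *)
Require Import Defs.
From mathcomp Require Import all_boot.
From mathcomp Require Import finmap.
From mathcomp Require Import classical_sets.
Local Open Scope classical_set_scope.

(** In a logic above S4 the global consequence relation has the deduction
    theorem [X, a |- b] iff [X |- Box a -> b] ([deduction]).  Hence a finite
    list of formulas with conjunction [b] is inconsistent with [X] exactly when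
    [X] proves [~ Box b] ([inconsistent_cat]).  So the inconsistency condition
    determines an elementary IL-sequence up to interderivability: [Psi_n(al)]
    amounts to [~ Box b], and iterating, [Psi_{#n} Psi_n(al)] amounts to
    [~ Box ~ Box b] when [Psi_n] is nonempty ([elementary_IL_equiv],
    [PsiPsi_equiv]).  For every IL-sequence the WEML thereby becomes one and the
    same rule ([weak_excluded_middle]):
    from [X, ~ Box b |- phi] and [X, ~ Box ~ Box b |- phi] infer [X |- phi].

    By the deduction theorem again, this rule says that
    [Box ~ Box b \/ Box ~ Box ~ Box b] is a theorem for all [b], that is,
    [Dia Box b -> Box Dia Box b], which over S4 can be exchanged for the
    axiom [Dia Box v -> Box Dia v] ([weak_excluded_middleP]): one direction
    uses [Box b -> b] under [Box Dia], the other instantiates the axiom at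
    [Box b] and uses [Box b -> Box Box b]. *)

Set Implicit Arguments.
Unset Strict Implicit.
Unset Printing Implicit Defensive.

(** Evaluation treats variables and boxed formulas alike, so generalizing
    over the truth values of all subformulas left by reduction leaves only a
    truth table. *)
Ltac taut := let h := fresh "h" in move=> h /=;
  repeat match goal with
  | |- context [eval h ?a] => case: (eval h a)
  | |- context [h ?a] => case: (h a)
  end; done.

Definition conj (V : Type) (s : seq (Fm V)) : Fm V := foldr (@And V) Top s.

(** * Simultaneous substitution *)

Section Substitution.
Variables (V : choiceType) (v : nat -> V).
Hypothesis v_inj : injective v.

Lemma subst_conj (s : V -> Fm V) (t : seq (Fm V)) :
  subst s (conj t) = conj (map (subst s) t).
Proof. by elim: t => //= a t ->. Qed.

Lemma vars_conj (t : seq V) : vars (conj (map (@Var V) t)) = t.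
Proof. by elim: t => //= x t ->. Qed.

Lemma subst_subst (s t : V -> Fm V) a :
  subst s (subst t a) = subst (fun x => subst s (t x)) a.
Proof. by elim: a => //= [a ->|a -> b ->|a -> b ->|a -> b ->|a ->]. Qed.

Lemma eq_in_subst (s t : V -> Fm V) a :
  {in vars a, s =1 t} -> subst s a = subst t a.
Proof.
elim: a => //= [x|a IHa|a IHa b IHb|a IHa b IHb|a IHa b IHb|a IHa] st.
- by apply: st; rewrite inE.
- by rewrite IHa.
- by rewrite IHa ?IHb // => x xs; apply: st; rewrite mem_cat xs ?orbT.
- by rewrite IHa ?IHb // => x xs; apply: st; rewrite mem_cat xs ?orbT.
- by rewrite IHa ?IHb // => x xs; apply: st; rewrite mem_cat xs ?orbT.
- by rewrite IHa.
Qed.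

Lemma map_tsubst n (al : n.-tuple (Fm V)) :
  map (tsubst v al) (mkseq v n) = al.
Proof.
apply: (@eq_from_nth _ Top) => [|i]; rewrite size_map size_mkseq ?size_tuple //.
move=> lt_in; rewrite (nth_map (v 0)) ?size_mkseq // /tsubst.
rewrite index_uniq ?size_mkseq ?mkseq_uniq //.
by apply: set_nth_default; rewrite size_tuple.
Qed.

(** Restricting [Psi] to [Fm(m)] is essential: a variable outside
    [v_1, ..., v_m] survives the substitution of [t], so that [al] may still
    change it on the left-hand side, whereas the right-hand side keeps it. *)
Lemma inst_inst m n (Psi : set (Fm V)) (t : m.-tuple (Fm V))
    (al : n.-tuple (Fm V)) :
  Psi `<=` Fmn v m ->
  inst v (inst v Psi t) al
  = inst v Psi (map_tuple (subst (tsubst v al)) t).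
Proof.
move=> PsiF; rewrite /inst image_comp; apply: eq_imagel => a /PsiF aF /=.
rewrite subst_subst; apply: eq_in_subst => x /aF xm.
have ltxm : index x (mkseq v m) < size t.
  by rewrite size_tuple -{2}(size_mkseq v m) index_mem.
by rewrite /tsubst (nth_map (Var x)).
Qed.

End Substitution.

(** * Global consequence over S4 *)

Section Consequence.
Variables (V : choiceType) (v : nat -> V) (L : set (Fm V)).
Hypothesis v_inj : injective v.
Hypothesis L_normal : normal_logic v L.
Hypothesis L_S4 : S4 v `<=` L.

Local Notation "X |- a" := (gcons L X a) (at level 70).

Lemma gcons_set0 a : set0 |- a -> L a.
Proof.
elim=> // [b c _ Lbc _ Lb|b _ Lb]; first exact: normal_mp L_normal _ _ Lbc Lb.
exact: normal_nec L_normal _ Lb.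
Qed.

Lemma gcons_cut X Y a : cons_all (gcons L) Y X -> X |- a -> Y |- a.
Proof.
move=> YX; elim=> [b /YX //|b /gcons_thm //|b c _ bc _|b _].
  exact: gcons_mp.
exact: gcons_nec.
Qed.

Lemma gcons_taut X a : tautology a -> X |- a.
Proof. by move=> /(normal_taut L_normal) /gcons_thm. Qed.

Lemma gcons_taut1 X a b : tautology (Imp a b) -> X |- a -> X |- b.
Proof. by move=> /(gcons_taut X); apply: gcons_mp. Qed.

Lemma gcons_taut2 X a b c :
  tautology (Imp a (Imp b c)) -> X |- a -> X |- b -> X |- c.
Proof. by move=> ab_c /(gcons_taut1 ab_c); apply: gcons_mp. Qed.

Lemma gcons_trans X a b c :
  X |- Imp a b -> X |- Imp b c -> X |- Imp a c.
Proof. by apply: gcons_taut2; taut. Qed.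

Lemma gcons_contra X a b : X |- Imp a b -> X |- Imp (Neg b) (Neg a).
Proof. by apply: gcons_taut1; taut. Qed.

Lemma gcons_Box X a b : X |- Imp a b -> X |- Imp (Box a) (Box b).
Proof.
move=> /gcons_nec; apply/gcons_mp/gcons_thm.
have := normal_subst L_normal (fun x => if x == v 0 then a else b)
  (normal_K L_normal).
by rewrite /= eqxx (inj_eq v_inj).
Qed.

Lemma gcons_T X a : X |- Imp (Box a) a.
Proof.
apply/gcons_thm/(normal_subst L_normal (fun=> a) (a := axT v))/L_S4.
by move=> M _; apply; left.
Qed.

Lemma gcons_4 X a : X |- Imp (Box a) (Box (Box a)).
Proof.
apply/gcons_thm/(normal_subst L_normal (fun=> a) (a := ax4 v))/L_S4.
by move=> M _; apply; right.
Qed.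

(** The prefix [Box] on [a] absorbs the necessitations applied below [a] in a
    derivation, by transitivity [Box a -> Box Box a]. *)
Lemma deduction X a b : (X `|` [set a]) |- b <-> X |- Imp (Box a) b.
Proof.
split=> [|ab]; last first.
  apply: (@gcons_mp _ _ _ (Box a)); last by apply/gcons_nec/gcons_hyp; right.
  by apply: gcons_cut ab => c Xc; apply: gcons_hyp; left.
elim=> [c [Xc|->]|c Lc|c d _ cd _|c _ IHc].
- by apply: gcons_taut1 (gcons_hyp L Xc); taut.
- exact: gcons_T.
- by apply: gcons_taut1 (gcons_thm X Lc); taut.
- by apply: gcons_taut2 cd; taut.
- exact: gcons_trans (gcons_4 X a) (gcons_Box IHc).
Qed.

Lemma inconsistentP X : inconsistent (gcons L) X <-> X |- Bot.
Proof. by split=> [|XBot a]; [apply|apply: gcons_taut1 XBot; taut]. Qed.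

Lemma inconsistent1 X a :
  inconsistent (gcons L) (X `|` [set a]) <-> X |- Neg (Box a).
Proof.
apply: (iff_trans (inconsistentP _)); apply: (iff_trans (deduction _ _ _)).
by split; apply: gcons_taut1; taut.
Qed.

(** * Sets of hypotheses replaced by one formula *)

(** Interderivability of [Y] and [c], in the form in which an IL-sequence
    provides it. *)
Definition equiv (Y : set (Fm V)) (c : Fm V) : Prop :=
  forall X, cons_all (gcons L) X Y <-> X |- c.

Lemma equiv_hyp Y c X a : equiv Y c ->
  (X `|` Y) |- a <-> (X `|` [set c]) |- a.
Proof.
move=> Yc; split; apply: gcons_cut => b [Xb|].
- by apply: gcons_hyp; left.
- by move: b; apply/Yc/gcons_hyp; right.
- by apply: gcons_hyp; left.
- by move=> ->; apply/Yc => d Yd; apply: gcons_hyp; right.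
Qed.

Lemma equiv_conj (s : seq (Fm V)) : equiv [set` s] (conj s).
Proof.
move=> X; elim: s => /= [|a s IHs].
  by split=> // _; apply: gcons_taut; taut.
split=> [Xas|Xas b].
  have Xa : X |- a by apply: Xas; rewrite /= inE eqxx.
  have : X |- conj s.
    by apply/IHs => b bs; apply: Xas; rewrite /= inE (bs : b \in s) orbT.
  by apply: gcons_taut2 Xa; taut.
rewrite /= inE => /predU1P[->|bs]; first by apply: gcons_taut1 Xas; taut.
by apply: (IHs.2 _ b bs); apply: gcons_taut1 Xas; taut.
Qed.

Lemma inconsistent_equiv Y c X : equiv Y c ->
  inconsistent (gcons L) (X `|` Y) <-> X |- Neg (Box c).
Proof.
move=> Yc; apply: (iff_trans _ (inconsistent1 _ _)).
by split=> XY a; apply/(equiv_hyp _ _ Yc).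
Qed.

Lemma inconsistent_cat (s : seq (Fm V)) X :
  inconsistent (gcons L) (X `|` [set` s]) <-> X |- Neg (Box (conj s)).
Proof. exact/inconsistent_equiv/equiv_conj. Qed.

(** * IL-sequences *)

Lemma elementary_IL_equiv Psi n (al : n.-tuple (Fm V)) :
  elementary_IL v (gcons L) Psi -> 0 < n ->
  equiv (inst v [set` Psi n] al) (Neg (Box (conj al))).
Proof.
move=> Psi_IL n0 X; have [_ /(_ X al) PsiX] := Psi_IL _ n0.
exact: iff_trans (iff_sym PsiX) (inconsistent_cat _ _).
Qed.

(** Being derivable from [X] means for [Psi_{#n} Psi_n(al)] that [X] is
    inconsistent with [Psi_n(al)], to which the description of [Psi_n(al)] by
    a single formula applies. *)
Lemma PsiPsi_equiv Psi n (al : n.-tuple (Fm V)) :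
  elementary_IL v (gcons L) Psi -> 0 < n -> 0 < #|` Psi n|%fset ->
  equiv (inst v (PsiPsi v Psi n) al) (Neg (Box (Neg (Box (conj al))))).
Proof.
move=> Psi_IL n0 k0 X; have [PsiF IL] := Psi_IL _ k0.
rewrite /PsiPsi (inst_inst _ _ PsiF).
apply: (iff_trans (iff_sym (IL _ _))).
have -> : [set` map_tuple (subst (tsubst v al)) (in_tuple (enum_fset (Psi n)))]
    = inst v [set` Psi n] al.
  apply/seteqP; split=> [b /mapP[a aPsi ->]|_ [a aPsi <-]]; first by exists a.
  exact: map_f.
exact/inconsistent_equiv/elementary_IL_equiv.
Qed.

(** The deduction theorem turns inconsistency with [al] into
    derivability of [~ Box] of the conjunction, whence this sequence, in which
    every [Psi_n] is a singleton. *)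
Definition canonical_IL (n : nat) : {fset Fm V} :=
  [fset Neg (Box (conj (map (@Var V) (mkseq v n))))]%fset.

Lemma canonical_IL_elementary : elementary_IL v (gcons L) canonical_IL.
Proof.
move=> n _; split=> [a|X al].
  rewrite /= inE => /eqP ->; rewrite /Fmn /= vars_conj; exact.
apply: (iff_trans (inconsistent_cat _ _)).
have subE : subst (tsubst v al) (Neg (Box (conj (map (@Var V) (mkseq v n)))))
    = Neg (Box (conj al)).
  by rewrite /= subst_conj -map_comp (map_tsubst v_inj).
split=> [XN _ [a + <-]|]; first by rewrite /= inE => /eqP ->; rewrite subE.
by apply; rewrite -subE; eexists=> //; rewrite /= inE.
Qed.

(** * The weak excluded middle *)

Definition weak_excluded_middle : Prop := forall X b phi,
  (X `|` [set Neg (Box b)]) |- phi ->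
  (X `|` [set Neg (Box (Neg (Box b)))]) |- phi -> X |- phi.

Lemma has_WEMLP : has_WEML v (gcons L) <-> weak_excluded_middle.
Proof.
split=> [[Psi Psi_IL wem] X b phi Xb XNb|wem].
  have Psi1 := elementary_IL_equiv [tuple b] Psi_IL (ltn0Sn 0).
  (* The conjunction of the one-entry list is [And b Top], hence the need to
     replace [b] by it. *)
  have bTop : forall Y, Y |- Imp (Box b) (Box (And b Top)).
    by move=> Y; apply/gcons_Box/gcons_taut; taut.
  have Topb : forall Y, Y |- Imp (Box (And b Top)) (Box b).
    by move=> Y; apply/gcons_Box/gcons_taut; taut.
  have X1 : (X `|` inst v [set` Psi 1] [tuple b]) |- phi.
    apply/(equiv_hyp _ _ Psi1); apply/deduction; move/deduction: Xb.
    by apply/gcons_trans/gcons_Box/gcons_contra.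
  apply: (wem 1 (ltn0Sn 0) X [tuple b] phi X1).
  (* If [Psi_1] is empty, its instances add nothing to [X]. *)
  have [Psi0|k0] := posnP #|` Psi 1|%fset.
    apply: gcons_cut X1 => a [Xa|[c]]; first by apply: gcons_hyp; left.
    by rewrite /= (cardfs0_eq Psi0) inE.
  apply/(equiv_hyp _ _ (PsiPsi_equiv _ Psi_IL (ltn0Sn 0) k0)).
  apply/deduction; move/deduction: XNb.
  by apply/gcons_trans/gcons_Box/gcons_contra/gcons_Box/gcons_contra.
exists canonical_IL; first exact: canonical_IL_elementary.
move=> n n0 X al phi.
have Psi_IL := canonical_IL_elementary.
move=> /(equiv_hyp _ _ (elementary_IL_equiv al Psi_IL n0)) Xb.
have k0 : 0 < #|` canonical_IL n|%fset by rewrite cardfs1.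
by move=> /(equiv_hyp _ _ (PsiPsi_equiv al Psi_IL n0 k0)); apply: wem Xb.
Qed.

Lemma weak_excluded_middleP : weak_excluded_middle <-> set0 |- axG v.
Proof.
split=> [wem|G X b phi].
  apply: (wem set0 (Var (v 0))); apply/deduction.
    by apply: gcons_taut; taut.
  have : set0 |- Imp (Box (Dia (Box (Var (v 0))))) (Box (Dia (Var (v 0)))).
    by do 2!apply/gcons_Box/gcons_contra; apply: gcons_T.
  by apply: gcons_taut1; taut.
move=> /deduction Xb /deduction XNb.
have GX : X |- Imp (Dia (Box (Box b))) (Box (Dia (Box b))).
  have LG : L (axG v) := gcons_set0 G.
  exact: gcons_thm (normal_subst L_normal (fun=> Box b) LG).
have N4 : X |- Imp (Box (Neg (Box (Box b)))) (Box (Neg (Box b))).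
  exact/gcons_Box/gcons_contra/gcons_4.
have DiaBox : X |- Imp (Dia (Box (Box b))) phi := gcons_trans GX XNb.
have BoxNeg := gcons_trans N4 Xb.
by apply: gcons_taut2 DiaBox BoxNeg; taut.
Qed.

Lemma S42_subP : set0 |- axG v <-> S42 v `<=` L.
Proof.
split=> [G a|]; last first.
  by move=> S42L; apply/gcons_thm/S42L => M _; apply; right.
apply=> // b [|->]; first exact: L_S4.
exact: gcons_set0.
Qed.

End Consequence.

Theorem theorem10p2 (V : choiceType) (v : nat -> V) (v_inj : injective v)
    (L : set (Fm V)) (L_normal : normal_logic v L) (L_S4 : S4 v `<=` L) :
  (has_WEML v (gcons L) <-> gcons L set0 (axG v)) /\
  (gcons L set0 (axG v) <-> S42 v `<=` L).
Proof.
split; last exact: S42_subP.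
apply: (iff_trans (has_WEMLP v_inj L_normal L_S4)).
exact: weak_excluded_middleP.
Qed.
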